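(* Let $q$ be a prime power, $k=\mathbb F_q$, $\ell=\mathbb F_{q^2}$, and $\overline a=a^q$ for $a\in\ell$. Let $V=\ell^3$ carry a nondegenerate Hermitian form $h$ of Witt index one. Define $$\partial_q=\{[x]\in\mathbb P(V):h(x,x)=0\},\qquad \mathcal P_q=\{[p]\in\mathbb P(V):h(p,p)\neq0\},$$ and for $[p]\in\mathcal P_q$ define the chain $\mathcal C_p=\{[x]\in\partial_q:h(x,p)=0\}$. Then $$|\partial_q|=q^3+1,\qquad |\mathcal P_q|=q^2(q^2-q+1).$$ Each chain contains $q+1$ points of $\partial_q$, each point of $\partial_q$ lies on $q^2$ chains, and any two distinct points of $\partial_q$ lie on a unique chain. Equivalently, the null points $\partial_q$ (as points) and the anisotropic poles $\mathcal P_q$ (as blocks, via their chains) form the finite Hermitian unital of order $q$, a $2$-$(q^3+1,q+1,1)$ incidence structure.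
   Context: A Hermitian form $h$ on $V$ is linear in the first argument, conjugate-linear in the second with respect to $a\mapsto\overline a$, and satisfies $h(w,z)=\overline{h(z,w)}$. Witt index one means maximal totally isotropic subspaces have dimension one. $\mathbb P(V)$ is the set of $\ell$-lines in $V$. A $2$-$(v,m,1)$ incidence structure has $v$ points, every block contains $m$ points, and any two distinct points lie on exactly one block. *)

(* Defs.v *)
From HB Require Import structures.
From mathcomp Require Import all_boot all_order all_algebra.

Set Implicit Arguments.
Unset Strict Implicit.
Unset Printing Implicit Defensive.

Import GRing.Theory VectorInternalTheory.
Local Open Scope ring_scope.

(* Needed to form and count sets of projective points, which are represented
   by the corresponding subspaces <[x]>%VS. *)
HB.instance Definition _ (K : finFieldType) (vT : vectType K) :=
  [Countable of {vspace vT} by <:].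
HB.instance Definition _ (K : finFieldType) (vT : vectType K) :=
  [Finite of {vspace vT} by <:].

Section WittIndex.
Variables (K : fieldType) (vT : vectType K) (h : vT -> vT -> K).

Definition totally_isotropic (U : {vspace vT}) : Prop :=
  forall u v, u \in U -> v \in U -> h u v = 0.

Definition maximal_totally_isotropic (U : {vspace vT}) : Prop :=
  totally_isotropic U /\
  forall W : {vspace vT}, totally_isotropic W -> (U <= W)%VS -> W = U.

Definition has_witt_index (n : nat) : Prop :=
  forall U : {vspace vT}, maximal_totally_isotropic U -> \dim U = n.

End WittIndex.

Record incidence_structure := IncidenceStructure {
  point : finType;
  block : finType;
  incident : point -> block -> bool }.

Definition is_2_design1 (S : incidence_structure) (v m : nat) : Prop :=
  [/\ #|point S| = v,
      forall b : block S, #|[set x | incident x b]| = m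
    & forall x y : point S, x != y ->
        exists! b : block S, incident x b /\ incident y b].

Section HermitianUnital.
Variable l : finFieldType.
Local Notation V := 'rV[l]_3.
Variable h : V -> V -> l.

Definition null_points : {set {vspace V}} :=
  [set <[x]>%VS | x : V & (x != 0) && (h x x == 0)].

Definition poles : {set {vspace V}} :=
  [set <[p]>%VS | p : V & (p != 0) && (h p p != 0)].

(* The condition h x p = 0 is imposed for all p in the line P, so that no
   representative has to be chosen; see [chain_line]. *)
Definition chain (P : {vspace V}) : {set {vspace V}} :=
  [set <[x]>%VS | x : V &
     [&& x != 0, h x x == 0 & [forall p in P, h x p == 0]]].

Definition chains : {set {set {vspace V}}} := [set chain P | P in poles].

Definition hermitian_unital : incidence_structure :=
  @IncidenceStructure
    {X : {vspace V} | X \in null_points} {P : {vspace V} | P \in poles}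
    (fun X P => val X \in chain (val P)).

End HermitianUnital.

Lemma chain_line (l : finFieldType) (conj : {rmorphism l -> l})
    (h : {hermitian 'rV[l]_3 for false & conj}) (p : 'rV[l]_3) :
  chain h <[p]> =
  [set <[x]>%VS | x : 'rV[l]_3 & [&& x != 0, h x x == 0 & h x p == 0]].
Proof.
have E x : [forall p0 in <[p]>%VS, h x p0 == 0] = (h x p == 0).
  apply/forall_inP/idP => [-> // | /eqP hxp _ /vlineP[a ->]].
    exact: memv_line.
  by rewrite linearZ /= hxp mulr0.
by apply/setP => X; apply/imsetP/imsetP => -[x]; rewrite !inE => Hx ->;
  exists x; rewrite // !inE; move: Hx; rewrite E.
Qed.

(* Main.v *)
(* Trace and norm from l to the fixed field of conj are understood by counting
   fibres: their fibres have at most q and q + 1 elements, being sets of roots,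
   and comparison of cardinals forces equality.  Since the norm is onto, every
   plane contains a null vector m.  If U is a subspace containing m but not
   orthogonal to it, a null point of U other than <m> has a unique
   representative y with h y m = 1; translating along m, the trace count shows
   that a proportion 1/q of these y is null.  Taking U = V and U = p^_|_ gives
   the q^3 + 1 null points and the q + 1 points of each chain.  Two distinct
   null points span a nondegenerate plane, so the only pole orthogonal to both is
   the line orthogonal to that plane; hence a chain determines its pole, and
   the chains through a null point X correspond to the q^2 lines of X^_|_ other
   than X. *)
Require Import Defs.
From mathcomp Require Import all_boot all_order all_algebra all_field.
From mathcomp Require Import zify.

Set Implicit Arguments.
Unset Strict Implicit.
Unset Printing Implicit Defensive.

Import GRing.Theory.
Local Open Scope ring_scope.

(** The fibre sizes add up to [m * n], while their upper bounds add up to at most [m * n], so every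
    bound is attained. *)
Lemma card_fibers_eq (A B : finType) (f : A -> B) (D : {set A}) (E : {set B})
    (m n : nat) :
  {in D, forall x, f x \in E} ->
  {in E, forall y, #|[set x in D | f x == y]| <= m}%N ->
  #|D| = (m * n)%N -> (#|E| <= n)%N ->
  {in E, forall y, #|[set x in D | f x == y]| = m}.
Proof.
move=> DE le_m cardD cardE.
have cardDE : #|D| = (\sum_(y in E) #|[set x in D | f x == y]|)%N.
  rewrite -sum1_card (partition_big f (mem E)) //=.
  by apply: eq_bigr => y _; rewrite -sum1_card; apply: eq_bigl => x;
    rewrite inE.
have /leqif_sum le_sum : forall y, y \in E ->
    (#|[set x in D | f x == y]| <= m
       ?= iff (#|[set x in D | f x == y]| == m))%N.
  by move=> y yE; split; first exact: le_m.
have := le_sum; rewrite -cardDE => -[_].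
have -> : (#|D| == \sum_(y in E) m)%N.
  rewrite eqn_leq {1}cardDE leq_sum //= sum_nat_const cardD mulnC.
  by rewrite leq_mul2l cardE orbT.
by move/esym/forall_inP => eq_m y /eq_m/eqP.
Qed.

Lemma card_roots_le (R : finFieldType) (p : {poly R}) :
  p != 0 -> (#|[set x | root p x]| <= (size p).-1)%N.
Proof.
move=> p_neq0; rewrite -ltnS prednK ?size_poly_gt0 // cardE max_poly_roots //.
  by apply/allP => x; rewrite mem_enum inE.
exact: enum_uniq.
Qed.

(** * Trace and norm of the quadratic extension *)

Section FrobeniusConjugation.
Variables (l : finFieldType) (q : nat).
Hypothesis card_l : #|l| = (q ^ 2)%N.
Variable conj : {rmorphism l -> l}.
Hypothesis conjE : forall a : l, conj a = a ^+ q.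

Lemma order_gt1 : (1 < q)%N.
Proof. by have := finNzRing_gt1 l; rewrite card_l; case: q => [|[]]. Qed.

Lemma conjK : involutive conj.
Proof. by move=> a; rewrite !conjE -exprM mulnn -card_l expf_card. Qed.

Lemma card_fixed_conj : (#|[set a | conj a == a]| <= q)%N.
Proof.
have sz : size ('X^q - 'X : {poly l}) = q.+1.
  by rewrite size_polyDl ?size_polyN ?size_polyXn ?size_polyX // ltnS order_gt1.
have nz : 'X^q - 'X != 0 :> {poly l} by rewrite -size_poly_gt0 sz.
have := card_roots_le nz; rewrite sz /=; apply: leq_trans.
apply: subset_leq_card; apply/subsetP => a.
by rewrite !inE rootE !hornerE conjE subr_eq0.
Qed.

(** The trace sends [q ^ 2] elements into at most [q] fixed ones, and the fibre over [d] consists of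
    roots of [X^q + X - d], of degree [q]. *)
Lemma card_trace_fiber (c : l) : conj c = c -> #|[set a | a + conj a == c]| = q.
Proof.
move=> cfix; pose K := [set a | conj a == a].
have -> : [set a | a + conj a == c] = [set a in setT | a + conj a == c].
  by apply/setP => a; rewrite !inE.
apply: (@card_fibers_eq _ _ _ _ K q q); last by rewrite inE cfix.
- by move=> a _; rewrite inE rmorphD /= conjK addrC.
- move=> d _; pose p : {poly l} := 'X^q + ('X - d%:P).
  have sz : size p = q.+1.
    by rewrite size_polyDl ?size_polyXn ?size_XsubC // ltnS order_gt1.
  have nz : p != 0 by rewrite -size_poly_gt0 sz.
  have := card_roots_le nz; rewrite sz /=; apply: leq_trans.
  apply: subset_leq_card; apply/subsetP => a; rewrite !inE rootE !hornerE conjE.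
  by rewrite subr_eq0 addrC.
- by rewrite cardsT card_l mulnn.
exact: card_fixed_conj.
Qed.

(** For [c] nonzero, count on nonzero elements: [q^2 - 1 = (q + 1)(q - 1)], at most [q - 1] nonzero
    elements are fixed, and each fibre consists of roots of some [X^(q+1) - d]. All fibres then have
    [q + 1] elements, so none is empty. *)
Lemma norm_onto (c : l) : conj c = c -> exists a, a * conj a = c.
Proof.
move=> cfix; have [-> | c_neq0] := eqVneq c 0; first by exists 0; rewrite mul0r.
pose K := [set a | conj a == a] :\ 0.
have fiber : #|[set a in [set~ 0] | a * conj a == c]| = q.+1.
  apply: (@card_fibers_eq _ _ _ _ K q.+1 q.-1);
    last by rewrite !inE c_neq0 cfix /=.
  - move=> a; rewrite !inE => a_neq0.
    by rewrite mulf_neq0 ?fmorph_eq0 //= rmorphM /= conjK mulrC.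
  - move=> d _; pose p : {poly l} := 'X^(q.+1) - d%:P.
    have sz : size p = q.+2 by rewrite size_XnsubC.
    have nz : p != 0 by rewrite -size_poly_gt0 sz.
    have := card_roots_le nz; rewrite sz /=; apply: leq_trans.
    apply: subset_leq_card; apply/subsetP => a;
      rewrite !inE rootE !hornerE conjE.
    by rewrite exprS subr_eq0 => /andP[].
  - rewrite cardsC1 card_l; case: (q) => // r.
    by rewrite -mulnn mulSn addSn /= [RHS]mulSn mulnC.
  rewrite -ltnS prednK ?(ltnW order_gt1) //; apply: leq_trans card_fixed_conj.
  by rewrite [X in (_ < X)%N](cardsD1 0) !inE rmorph0 eqxx.
have := ltn0Sn q; rewrite -fiber => /card_gt0P[a].
by rewrite !inE => /andP[_ /eqP]; exists a.
Qed.

End FrobeniusConjugation.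

(** * Counting the lines of a subspace *)

Section Lines.
Variables (l : finFieldType) (n : nat).
Local Notation V := 'rV[l]_n.
Implicit Types (U X : {vspace V}) (x y : V).

Definition lines_in U : {set {vspace V}} :=
  [set X : {vspace V} | (\dim X == 1%N) && (X <= U)%VS].

Lemma dim_eq1P X : reflect (exists2 x, x != 0 & X = <[x]>%VS) (\dim X == 1%N).
Proof.
apply: (iffP idP) => [/eqP dimX | [x x_neq0 ->]];
  last by rewrite dim_vline x_neq0.
have X_neq0 : X != 0%VS by rewrite -dimv_eq0 dimX.
exists (vpick X); first by rewrite vpick0.
by apply/esym/eqP; rewrite eqEdim -memvE memv_pick dim_vline vpick0 X_neq0 dimX.
Qed.

Lemma vline_eq x y : x != 0 -> x \in <[y]>%VS -> <[x]>%VS = <[y]>%VS.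
Proof.
move=> x_neq0 xy; apply/eqP; rewrite eqEdim -memvE xy !dim_vline x_neq0.
by case: (y != 0).
Qed.

(** Sort the nonzero vectors of [U] by the line they span: each line carries [#|l| - 1] of them. The
    product form avoids a division. *)
Lemma card_lines_in U :
  (#|lines_in U| * (#|l|).-1 = (#|l| ^ \dim U).-1)%N.
Proof.
rewrite -card_vspace [in RHS](cardD1 0) mem0v /= -sum_nat_const.
rewrite -[in RHS]sum1_card.
rewrite [RHS](partition_big (fun x : V => <[x]>%VS) (mem (lines_in U))) /=.
  apply: eq_bigr => X; rewrite inE => /andP[/eqP dimX XU].
  have -> : #|l|.-1 = #|X|.-1 by rewrite card_vspace dimX expn1.
  rewrite [in LHS](cardD1 0) mem0v /= -sum1_card; apply: eq_bigl => x;
    rewrite !inE.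
  have [-> | x_neq0] //= := eqVneq x 0.
  apply/idP/andP => [xX | [_ /eqP <-]]; last exact: memv_line.
  split; first by apply: subvP xX.
  by rewrite eqEdim -memvE xX dim_vline x_neq0 dimX.
by move=> x; rewrite !inE -memvE dim_vline => /andP[-> ->].
Qed.

End Lines.

(** * Null vectors and orthogonality for Hermitian forms *)

Section HermitianForm.
Variables (l : finFieldType) (q : nat).
Hypothesis card_l : #|l| = (q ^ 2)%N.
Variable conj : {rmorphism l -> l}.
Hypothesis conjE : forall a : l, conj a = a ^+ q.
Variables (n : nat) (h : {hermitian 'rV[l]_n for false & conj}).
Local Notation V := 'rV[l]_n.
Implicit Types (U : {vspace V}) (x y z : V).

Lemma herm0l x : h 0 x = 0. Proof. exact: linear0l. Qed.

Lemma hermDl x y z : h (x + y) z = h x z + h y z. Proof. exact: linearDl. Qed.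

Lemma hermBl x y z : h (x - y) z = h x z - h y z. Proof. exact: linearBl. Qed.

Lemma hermZl a x z : h (a *: x) z = a * h x z. Proof. exact: linearZl_LR. Qed.

Lemma hermDr x y z : h z (x + y) = h z x + h z y. Proof. exact: linearDr. Qed.

Lemma hermZr a x z : h z (a *: x) = conj a * h z x.
Proof. exact: linearZr_LR. Qed.

Lemma mem_orthov_line x y : (x \in orthov h <[y]>) = (h x y == 0).
Proof. exact: mem_orthov1. Qed.

Lemma herm_eq0_sym x y : (h x y == 0) = (h y x == 0).
Proof. exact: herm_eq0C. Qed.

Lemma herm_conj x y : conj (h x y) = h y x.
Proof. by rewrite [RHS]hermC expr0 mul1r. Qed.

(** Take orthogonal nonzero [u], [w] in [U]. If neither is null, surjectivity of the norm gives [c]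
    with [c * conj c = - h w w / h u u], and [c *: u + w] is null. *)
Lemma exists_null_vector U :
  (1 < \dim U)%N -> exists x, [/\ x \in U, x != 0 & h x x = 0].
Proof.
move=> dimU; have U_neq0 : U != 0%VS by rewrite -dimv_eq0 -lt0n ltnW.
pose u := vpick U; have u_neq0 : u != 0 by rewrite vpick0.
have uU : u \in U by apply: memv_pick.
have [hu0 | hu] := eqVneq (h u u) 0; first by exists u.
pose W := (U :&: orthov h <[u]>)%VS.
have W_neq0 : W != 0%VS.
  rewrite -dimv_eq0 -lt0n; apply: leq_trans (leq_dim_orthov1 h u U).
  by rewrite -ltnS prednK // ltnW.
pose w := vpick W; have w_neq0 : w != 0 by rewrite vpick0.
have := memv_pick W; rewrite -/w memv_cap mem_orthov_line => /andP[wU /eqP hwu].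
have huw : h u w = 0 by apply/eqP; rewrite herm_eq0_sym hwu.
have [hw0 | hw] := eqVneq (h w w) 0; first by exists w.
have [c normc] : exists c, c * conj c = - h w w / h u u.
  by apply: norm_onto card_l _ conjE _ _;
    rewrite fmorph_div rmorphN /= !herm_conj.
exists (c *: u + w); split; first by rewrite memvD ?memvZ.
  (* If the sum vanished, pairing it with [u] would force [c = 0], hence [w = 0]. *)
  apply: contra_neq hw => cuw0.
  have : h (c *: u + w) u = 0 by rewrite cuw0 herm0l.
  rewrite hermDl hermZl hwu addr0 => /eqP.
  rewrite mulf_eq0 (negPf hu) orbF => /eqP c0.
  by move: cuw0; rewrite c0 scale0r add0r => ->; rewrite herm0l.
rewrite hermDl !hermDr hermZl !hermZr hermZl /= huw hwu.
by rewrite !mulr0 addr0 add0r mulrA normc divfK // addNr.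
Qed.

(* On an orbit [y + t m] of translations by the null vector [m], the value of
   the form is [h y y + Tr t], which vanishes for exactly [q] values of [t]. *)
Lemma card_affine_null U m :
  m \in U -> h m m = 0 -> m \notin orthov h U ->
  (#|[set y in U | (h y m == 1%R) && (h y y == 0%R)]| * q
     = (#|l| ^ (\dim U).-1))%N.
Proof.
move=> mU hmm mNU; rewrite (eq_dim_orthov1 mNU) -card_vspace.
pose S : {set V} := [set y in U | h y m == 1].
have [z zU hzm] : exists2 z, z \in U & h z m = 1.
  have /mem_orthovPn[z zU hmz] := mNU.
  exists ((h z m)^-1 *: z); first exact: memvZ.
  by rewrite hermZl /= mulVf // herm_eq0_sym.
(* [S] is the translate by [z] of the hyperplane of [U] orthogonal to [m]. *)
have -> : #|(U :&: orthov h <[m]>)%VS| = #|S|.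
  rewrite -(card_imset (mem (U :&: orthov h <[m]>)%VS) (addrI z)).
  apply: eq_card => y; rewrite inE; apply/imsetP/andP => [[x] | [yU /eqP hym]].
    rewrite /= memv_cap mem_orthov_line => /andP[xU /eqP hxm] ->.
    by rewrite memvD // hermDl hxm addr0 hzm.
  exists (y - z); last by rewrite addrC subrK.
  by rewrite /= memv_cap mem_orthov_line memvB // hermBl hym hzm subrr eqxx.
have q_gt0 : (0 < q)%N by apply/ltnW/(order_gt1 card_l).
apply/eqP; rewrite -(eqn_pmul2r q_gt0) -mulnA mulnn -card_l; apply/eqP.
have null_orbit y : y \in S ->
    #|[set t | h (y + t *: m) (y + t *: m) == 0]| = q.
  rewrite inE => /andP[yU /eqP hym].
  have hmy : h m y = 1 by rewrite -herm_conj hym rmorph1.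
  rewrite -[RHS](card_trace_fiber card_l conjE (c := - h y y)).
    apply: eq_card => t; rewrite !inE hermDl !hermDr hermZl !hermZr.
    rewrite hermZl /= hmm hmy hym !mulr0 !mulr1 addr0 -addrA addrC addr_eq0.
    by rewrite [t + _]addrC.
  by rewrite rmorphN /= herm_conj.
rewrite -[RHS]sum_nat_const -(eq_bigr _ null_orbit) mulnC -[LHS]sum_nat_const.
(* Both sides count the pairs [(t, y)] with [y] in [S] and [y + t *: m] null. For fixed [t],
   translation by [t *: m] permutes [S] and maps these [y] onto its null vectors; for fixed [y],
   [null_orbit] gives [q] values of [t]. *)
pose isnull t y := h (y + t *: m) (y + t *: m) == 0.
transitivity (\sum_(t in l) \sum_(y in S | isnull t y) 1)%N.
  apply: eq_bigr => t _; rewrite sum1dep_card.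
  rewrite -[RHS](card_imset _ (addIr (t *: m))); apply: eq_card => y.
  apply/idP/imsetP => [|[x]].
    rewrite !inE => /and3P[yU hym hyy]; exists (y - t *: m);
      last by rewrite subrK.
    by rewrite !inE /isnull subrK hyy memvB ?memvZ // hermBl hermZl /= hmm
      mulr0 subr0 hym.
  rewrite !inE /isnull => /andP[/andP[xU hxm] hxx] ->.
  by rewrite memvD ?memvZ // hxx hermDl hermZl /= hmm mulr0 addr0 hxm.
rewrite (exchange_big_dep (mem S)) //=; last by move=> t y _ /andP[].
by apply: eq_bigr => y yS; rewrite sum1dep_card; apply: eq_card => t;
  rewrite [LHS]inE [RHS]inE yS.
Qed.

Hypothesis h_nondeg : nondegenerate h.

Lemma notin_radical x : x != 0 -> x \notin orthov h fullv.
Proof. by rewrite (eqP h_nondeg) memv0. Qed.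

Lemma dim_orthov1 x : x != 0 -> \dim (orthov h <[x]>) = n.-1.
Proof.
move=> x_neq0; have := eq_dim_orthov1 (notin_radical x_neq0).
by rewrite capfv dimvf /dim /= mul1n => ->.
Qed.

(** For nonzero [x], choose [z] not orthogonal to [x]; then [z] and the vectors orthogonal to [x]
    span everything. Subtracting from [y] the multiple of [x] with the same pairing with [z] leaves
    a vector of the radical, which is zero. *)
Lemma orthov1K x y : y \in orthov h (orthov h <[x]>) -> y \in <[x]>%VS.
Proof.
have [-> | x_neq0] := eqVneq x 0.
  rewrite orthov0 => y0; rewrite -(eqP h_nondeg).
  by apply/mem_orthovP => v _; apply: (mem_orthovP y0); rewrite memvf.
move=> /mem_orthovP hy; have /mem_orthovPn[z _ hxz] := notin_radical x_neq0.
suff /eqP : y - (h y z / h x z) *: x = 0.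
  by rewrite subr_eq0 => /eqP ->; rewrite memvZ ?memv_line.
apply/eqP; rewrite -memv0 -(eqP h_nondeg); apply/mem_orthovP => v _.
have hzx : h z x != 0 by rewrite herm_eq0_sym.
pose v0 := v - (h v x / h z x) *: z.
have v0x : h v0 x = 0 by rewrite hermBl hermZl /= divfK // subrr.
have -> : v = v0 + (h v x / h z x) *: z by rewrite subrK.
rewrite hermDr hermZr /= !hermBl !hermZl /= divfK // subrr mulr0 addr0.
have -> : h x v0 = 0 by apply/eqP; rewrite herm_eq0_sym v0x.
by rewrite mulr0 subr0 hy // mem_orthov_line v0x.
Qed.

Lemma dim_orthov2 x y : x != 0 -> y \notin <[x]>%VS ->
  \dim (orthov h <[x]> :&: orthov h <[y]>) = n.-2.
Proof.
move=> x_neq0 yNx; rewrite -(@eq_dim_orthov1 _ _ _ _ h y (orthov h <[x]>)).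
  by rewrite dim_orthov1.
by apply: contra yNx => /orthov1K.
Qed.

End HermitianForm.

(** * Null points and chains in the projective plane *)

Section Unital.
Variables (l : finFieldType) (q : nat).
Hypothesis card_l : #|l| = (q ^ 2)%N.
Variable conj : {rmorphism l -> l}.
Hypothesis conjE : forall a : l, conj a = a ^+ q.
Variable h : {hermitian 'rV[l]_3 for false & conj}.
Hypothesis h_nondeg : nondegenerate h.
Local Notation V := 'rV[l]_3.
Implicit Types (U X Y P : {vspace V}) (x y : V).

Lemma null_pointP X :
  reflect (exists x, [/\ x != 0, h x x = 0 & X = <[x]>%VS])
    (X \in null_points h).
Proof.
apply: (iffP imsetP) => [[x] | [x [x_neq0 hxx ->]]].
  by rewrite inE => /andP[x_neq0 /eqP hxx] ->; exists x.
by exists x; rewrite // inE x_neq0 hxx /=.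
Qed.

(** Rescaling a vector by [a] multiplies its value under the form by the norm of [a], so nullity
    does not depend on the representative. *)
Lemma null_point_line x :
  x != 0 -> (<[x]>%VS \in null_points h) = (h x x == 0).
Proof.
move=> x_neq0; apply/null_pointP/eqP => [[y [_ hyy xy]] | hxx];
  last by exists x.
have /vlineP[a ->] : x \in <[y]>%VS by rewrite -xy memv_line.
by rewrite hermZl hermZr hyy !mulr0.
Qed.

Lemma null_point_dim X : X \in null_points h -> \dim X = 1%N.
Proof. by case/null_pointP => x [x_neq0 _ ->]; rewrite dim_vline x_neq0. Qed.

Lemma mem_chain X p :
  (X \in chain h <[p]>) = (X \in null_points h) && (X <= orthov h <[p]>)%VS.
Proof.
rewrite chain_line;
  apply/imsetP/andP => [[x] | [/null_pointP[x [x_neq0 hxx ->]]]].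
  rewrite inE => /and3P[x_neq0 hxx hxp] ->.
  by rewrite null_point_line // -memvE mem_orthov_line.
by rewrite -memvE mem_orthov_line => hxp; exists x;
  rewrite // inE x_neq0 hxx eqxx.
Qed.

(** If [y] is not on the line of [x], the vectors orthogonal to both form a space of dimension
    [3 - 2 = 1]; it contains [x] and [y], so both span it. *)
Lemma null_orthogonal_eq x y :
  x != 0 -> y != 0 -> h x x = 0 -> h y y = 0 -> h x y = 0 ->
  <[x]>%VS = <[y]>%VS.
Proof.
move=> x_neq0 y_neq0 hxx hyy hxy.
have [yx | yNx] := boolP (y \in <[x]>%VS);
  first by rewrite (vline_eq y_neq0 yx).
have hyx : h y x = 0 by apply/eqP; rewrite herm_eq0_sym hxy.
have dim1 := dim_orthov2 h_nondeg x_neq0 yNx.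
have line z : z != 0 -> h z x = 0 -> h z y = 0 ->
    <[z]>%VS = (orthov h <[x]> :&: orthov h <[y]>)%VS.
  move=> z_neq0 hzx hzy; apply/eqP; rewrite eqEdim dim_vline z_neq0 dim1 andbT.
  by rewrite -memvE memv_cap !mem_orthov_line hzx hzy eqxx.
exact: etrans (line x x_neq0 hxx hxy) (esym (line y y_neq0 hyx hyy)).
Qed.

(** A null point other than [<[m]>] is not orthogonal to [m], so it can be normalised into [N],
    which has [(q^2)^(d+1) / q] elements. The case [d = 0] serves for chains and [d = 1] for the
    whole space. *)
Lemma card_null_points_in U d m :
  \dim U = d.+2 -> m \in U -> m != 0 -> h m m = 0 -> m \notin orthov h U ->
  #|[set X in null_points h | (X <= U)%VS]| = (q ^ d.*2.+1 + 1)%N.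
Proof.
move=> dimU mU m_neq0 hmm mNU.
pose N : {set V} := [set y in U | (h y m == 1) && (h y y == 0)].
have N_neq0 y : y \in N -> y != 0.
  rewrite inE => /and3P[_ hym _]; apply: contraTneq hym => ->.
  by rewrite herm0l eq_sym oner_eq0.
have cardN : #|N| = (q ^ d.*2.+1)%N.
  have q_gt0 : (0 < q)%N by apply/ltnW/(order_gt1 card_l).
  apply/eqP; rewrite -(eqn_pmul2r q_gt0) (card_affine_null card_l conjE) //.
  by rewrite dimU card_l -expnM -expnSr mul2n doubleS.
have -> : [set X in null_points h | (X <= U)%VS]
    = <[m]>%VS |: [set <[y]>%VS | y : V in N].
  apply/setP => X; rewrite !inE; apply/andP/orP => [[/null_pointP[x]] | ].
    case=> x_neq0 hxx ->; rewrite -memvE => xU.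
    have [hxm | hxm] := eqVneq (h x m) 0.
      by left; rewrite (null_orthogonal_eq x_neq0 m_neq0).
    right; apply/imsetP; exists ((h x m)^-1 *: x).
      by rewrite inE memvZ // !hermZl mulVf // hermZr hxx !mulr0 !eqxx.
    apply/esym/vline_eq; last by rewrite memvZ ?memv_line.
    by rewrite scaler_eq0 invr_eq0 (negPf hxm).
  case=> [/eqP -> | /imsetP[y yN ->]].
    by rewrite null_point_line // hmm eqxx -memvE.
  rewrite null_point_line ?N_neq0 // -memvE.
  by move: yN; rewrite inE => /and3P[].
(* The line [<[m]>] has no representative in [N] because [h m m = 0], and every other line has at
   most one because the pairing with [m] fixes the scalar. *)
rewrite cardsU1 card_in_imset ?cardN.
  suff -> : <[m]>%VS \notin [set <[y]>%VS | y : V in N] by rewrite addnC.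
  apply/imsetP => -[y]; rewrite inE => /and3P[_ hym _] my.
  have /vlineP[a ya] : y \in <[m]>%VS by rewrite my memv_line.
  by move: hym; rewrite ya hermZl hmm mulr0 eq_sym oner_eq0.
move=> y y'; rewrite !inE => /and3P[_ /eqP hym _] /and3P[_ /eqP hym' _] yy'.
have /vlineP[a ya] : y \in <[y']>%VS by rewrite -yy' memv_line.
by move: hym; rewrite ya hermZl hym' mulr1 => ->; rewrite scale1r.
Qed.

(** * Counting null points, chain points and poles *)

Lemma dim_rV3 : \dim {:V} = 3.
Proof. by rewrite dimvf. Qed.

Lemma card_null_points : #|null_points h| = (q ^ 3 + 1)%N.
Proof.
have [|m [_ m_neq0 hmm]] := exists_null_vector card_l conjE h (U := fullv).
  by rewrite dim_rV3.
rewrite -(@card_null_points_in fullv 1 m) ?dim_rV3 ?memvf ?notin_radical //.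
by apply: eq_card => X; rewrite inE subvf andbT.
Qed.

Lemma poleP P :
  reflect (exists p, [/\ p != 0, h p p != 0 & P = <[p]>%VS]) (P \in poles h).
Proof.
apply: (iffP imsetP) => [[p] | [p [p_neq0 hpp ->]]].
  by rewrite inE => /andP[p_neq0 hpp] ->; exists p.
by exists p; rewrite // inE p_neq0 hpp.
Qed.

Lemma card_chain P : P \in poles h -> #|chain h P| = (q + 1)%N.
Proof.
case/poleP => p [p_neq0 hpp ->].
have dimp : \dim (orthov h <[p]>) = 2 by rewrite dim_orthov1.
have [|m [mp m_neq0 hmm]] :=
    exists_null_vector card_l conjE h (U := orthov h <[p]>).
  by rewrite dimp.
rewrite -[X in (X + 1)%N]expn1 -(@card_null_points_in (orthov h <[p]>) 0 m) //.
  by apply: eq_card => X; rewrite mem_chain inE.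
(* A null [m] orthogonal to the whole plane would lie on the line of [p], making [p] null. *)
apply: contraNN hpp => /(orthov1K h_nondeg) mp'.
by rewrite -null_point_line // -(vline_eq m_neq0 mp') null_point_line // hmm.
Qed.

Lemma polesE : poles h = lines_in fullv :\: null_points h.
Proof.
apply/setP => P; rewrite !inE subvf andbT.
apply/poleP/andP => [[p [p_neq0 hpp ->]] | [PN /dim_eq1P[p p_neq0 def_P]]].
  by rewrite null_point_line // hpp dim_vline p_neq0.
by exists p; rewrite -null_point_line // -def_P.
Qed.

Lemma card_poles : #|poles h| = (q ^ 2 * (q ^ 2 - q + 1))%N.
Proof.
have q_gt1 := order_gt1 card_l.
have NL : null_points h \subset lines_in fullv.
  by apply/subsetP => X /null_point_dim dimX; rewrite inE dimX subvf.
rewrite polesE cardsD (setIidPr NL) card_null_points.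
have := card_lines_in (fullv : {vspace V}); rewrite dim_rV3 card_l.
case: q q_gt1 => [|[|r]] // _; set L := #|_| => cardL.
(* The plane has [(q^6 - 1) / (q^2 - 1)] points, of which [q^3 + 1] are null. Writing [q] as [r.+2]
   makes the divisor visibly positive. *)
suff -> : L = (r.+2 ^ 4 + r.+2 ^ 2 + 1)%N by nia.
by apply/eqP; rewrite -(eqn_pmul2r (_ : 0 < (r.+2 ^ 2).-1)%N) ?cardL //;
  apply/eqP; nia.
Qed.

Lemma card_poles_through X :
  X \in null_points h -> #|[set P in poles h | X \in chain h P]| = (q ^ 2)%N.
Proof.
move=> XN; have [x [x_neq0 hxx def_X]] := null_pointP _ XN.
have -> : [set P in poles h | X \in chain h P] = lines_in (orthov h X) :\ X.
  apply/setP => P; rewrite !inE; apply/andP/and3P.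
    case=> /poleP[p [p_neq0 hpp ->]]; rewrite mem_chain => /andP[_ Xp].
    split; last by rewrite orthov_sym.
      by apply: contraNneq hpp => pX; rewrite -null_point_line // pX.
    by rewrite dim_vline p_neq0.
  case=> PX /dim_eq1P[p p_neq0 def_P] PX0.
  rewrite def_P mem_chain XN -def_P orthov_sym PX0; split=> //.
  rewrite polesE !inE subvf def_P dim_vline p_neq0 null_point_line //.
  (* A null line orthogonal to [X] is [X] itself, so every other line orthogonal to [X] is a
     pole. *)
  rewrite eqxx !andbT; apply: contraNN PX => /eqP hpp; rewrite def_P def_X;
    apply/eqP.
  apply: null_orthogonal_eq => //; apply/eqP.
  by rewrite -mem_orthov_line memvE -def_X -def_P.
have := cardsD1 X (lines_in (orthov h X)).
have -> : X \in lines_in (orthov h X).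
  by rewrite inE null_point_dim // eqxx def_X -memvE mem_orthov_line hxx eqxx.
have := card_lines_in (orthov h X); rewrite {2}def_X dim_orthov1 // card_l /=.
have := order_gt1 card_l; case: q => [|[|r]] // _; set L := #|_|;
  set L' := #|_|.
(* A two-dimensional space has [(q^4 - 1) / (q^2 - 1)] lines; the summand 1 is the line [X] removed
   above. *)
move=> cardL; suff -> : L = (1 + r.+2 ^ 2)%N by move/addnI.
by apply/eqP; rewrite -(eqn_pmul2r (_ : 0 < (r.+2 ^ 2).-1)%N) ?cardL //;
  apply/eqP; nia.
Qed.

(** * Joining two null points, and passing from poles to chains *)

Lemma exists_unique_pole X Y :
  X \in null_points h -> Y \in null_points h -> X != Y ->
  exists! P, P \in poles h /\ (X \in chain h P /\ Y \in chain h P).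
Proof.
move=> XN YN; have [x [x_neq0 hxx def_X]] := null_pointP _ XN.
have [y [y_neq0 hyy def_Y]] := null_pointP _ YN; rewrite def_X def_Y => XY.
have yNx : y \notin <[x]>%VS.
  by apply/negP => /(vline_eq y_neq0) yx; rewrite yx eqxx in XY.
have := dim_orthov2 h_nondeg x_neq0 yNx; set P := (_ :&: _)%VS => dimP.
have /dim_eq1P[p p_neq0 def_P] : \dim P == 1%N by rewrite dimP.
have : p \in P by rewrite def_P memv_line.
rewrite memv_cap !mem_orthov_line => /andP[/eqP hpx /eqP hpy].
exists P; split.
  rewrite {2 3}def_P !mem_chain -def_X -def_Y XN YN def_X def_Y /=.
  rewrite -!memvE !mem_orthov_line !(herm_eq0_sym _ _ p) hpx hpy eqxx;
    split=> //.
  (* If [p] were null, its line, being orthogonal to both null points, would equal each of them. *)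
  apply/poleP; exists p; split=> //; apply: contraNneq XY => hpp.
  rewrite -(null_orthogonal_eq p_neq0 x_neq0) //.
  by rewrite (null_orthogonal_eq p_neq0 y_neq0).
move=> P' [/poleP[p' [p'_neq0 _ ->]]].
rewrite !mem_chain => -[/andP[_ Xp'] /andP[_ Yp']].
apply/esym/eqP; rewrite eqEdim dimP dim_vline p'_neq0 andbT subv_cap.
by rewrite ![(<[p']> <= _)%VS]orthov_sym Xp' Yp'.
Qed.

(** A chain has at least two points, and these determine the pole. This carries counts of poles over
    to [chains], where poles with equal chains would be merged. *)
Lemma chain_inj : {in poles h &, injective (chain h)}.
Proof.
move=> P Q PP QP eqPQ.
have /card_gt1P[X [Y [XP YP XY]]] : (1 < #|chain h P|)%N.
  by rewrite card_chain // addn1 ltnS ltnW // (order_gt1 card_l).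
have null Z : Z \in chain h P -> Z \in null_points h.
  by have /poleP[p [_ _ ->]] := PP; rewrite mem_chain => /andP[].
have [R [_ uniqR]] := exists_unique_pole (null _ XP) (null _ YP) XY.
by rewrite -(uniqR P) // -(uniqR Q) // -eqPQ.
Qed.

Lemma card_chains_through X :
  X \in null_points h -> #|[set C in chains h | X \in C]| = (q ^ 2)%N.
Proof.
move=> XN; rewrite -(card_poles_through XN).
rewrite -(card_in_imset (f := chain h)
  (D := [set P in poles h | X \in chain h P])).
  apply: eq_card => C; rewrite !inE; apply/andP/imsetP.
    by case=> /imsetP[P PP ->] XP; exists P; rewrite // inE PP.
  by case=> P; rewrite inE => /andP[PP XP] ->; rewrite XP imset_f.
by move=> P Q; rewrite !inE => /andP[PP _] /andP[QP _]; apply: chain_inj.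
Qed.

Lemma exists_unique_chain X Y :
  X \in null_points h -> Y \in null_points h -> X != Y ->
  exists! C, C \in chains h /\ (X \in C /\ Y \in C).
Proof.
move=> XN YN XY; have [P [[PP XYP] uniqP]] := exists_unique_pole XN YN XY.
exists (chain h P); split; first by rewrite imset_f.
by move=> C [/imsetP[Q QP ->] XYQ]; rewrite (uniqP Q).
Qed.

Lemma hermitian_unital_2_design :
  is_2_design1 (hermitian_unital h) (q ^ 3 + 1) (q + 1).
Proof.
split=> /=; first by rewrite card_sig card_null_points.
  move=> [P PP] /=; rewrite -(card_chain PP) -(card_imset _ val_inj).
  apply: eq_card => X; apply/imsetP/idP => [[X'] | XP].
    by rewrite inE => X'P ->.
  have XN : X \in null_points h.
    by move: XP; have /poleP[p [_ _ ->]] := PP; rewrite mem_chain => /andP[].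
  by exists (Sub X XN); rewrite ?inE.
move=> [X XN] [Y YN] /= XY; rewrite -val_eqE /= in XY.
have [P [[PP XYP] uniqP]] := exists_unique_pole XN YN XY.
exists (Sub P PP); split=> // -[Q QP] /= XYQ.
by apply: val_inj; rewrite /= (uniqP Q).
Qed.

End Unital.

Theorem theorem21p1
  (p e q : nat) (p_prime : prime p) (e_gt0 : (0 < e)%N) (q_def : q = (p ^ e)%N)
  (l : finFieldType) (card_l : #|l| = (q ^ 2)%N)
  (conj : {rmorphism l -> l}) (conjE : forall a : l, conj a = a ^+ q)
  (h : {hermitian 'rV[l]_3 for false & conj})
  (h_nondeg : nondegenerate h) (h_witt : has_witt_index h 1) :
  [/\ #|null_points h| = (q ^ 3 + 1)%N
    , #|poles h| = (q ^ 2 * (q ^ 2 - q + 1))%N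
    & [/\ forall P, P \in poles h -> #|chain h P| = (q + 1)%N
        , forall X, X \in null_points h ->
            #|[set C in chains h | X \in C]| = (q ^ 2)%N
        , forall X Y, X \in null_points h -> Y \in null_points h -> X != Y ->
            exists! C, C \in chains h /\ (X \in C /\ Y \in C)
        & is_2_design1 (hermitian_unital h) (q ^ 3 + 1) (q + 1)]].
Proof.
split; [exact: card_null_points | exact: card_poles |].
split; [exact: card_chain | exact: card_chains_through |
        exact: exists_unique_chain | exact: hermitian_unital_2_design].
Qed.
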